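(* Let $q\in\mathbb{N}^+$ and let $(G_n)_{n\ge0}$ be a sequence of finite $(q+1)$-regular graphs. For each $n$ let $\mathcal G_n$ be a subgroup of $U(N_n)$. Then $\mu(G_n)$ converges weakly to the Kesten–McKay distribution $\mu_q$ if and only if $\mu(G_n,\sigma_n)$ converges weakly to $\mu_q$ for every choice of $\mathcal G_n$-colors $(\sigma_n)_{n\ge0}$.
   Context: Graphs may have multi-edges and loops; each edge gives two mutually inverse directed edges $e,\overline e$ in $\vec E$, with origin $o(e)$ and terminus $t(e)$; the adjacency matrix has $A_{ab}=\#\{e\in\vec E:o(e)=a,t(e)=b\}$, and $(q+1)$-regular means every vertex is the origin of $q+1$ directed edges. A $\mathcal G$-color ($\mathcal G\le U(N)$) is a map $\sigma:\vec E\to\mathcal G$ with $\sigma(\overline e)=\sigma(e)^{-1}$; $A^\sigma$ is the $N|V|\times N|V|$ self-adjoint block matrix with blocks $(A^\sigma)_{ij}=\sum_{e: o(e)=i,t(e)=j}\sigma(e)$. Normalized spectral measures: $\mu(G)=\frac{1}{|V|}\sum_k\delta_{q^{-1/2}\lambda_k(A)}$ and $\mu(G,\sigma)=\frac{1}{N|V|}\sum_{k=1}^{N|V|}\delta_{q^{-1/2}\lambda_k(A^\sigma)}$, where $\lambda_k(\cdot)$ are eigenvalues. Kesten–McKay distribution: $d\mu_q(x)=\frac{1}{2\pi}\frac{(q+1)\sqrt{4-x^2}}{(q^{-1/2}+q^{1/2})^2-x^2}\mathbf 1_{|x|\le2}dx$. *)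

(* Defs.v *)
From HB Require Import structures.
From mathcomp Require Import all_boot all_order all_algebra.
From mathcomp Require Import all_classical all_reals all_analysis.
From mathcomp Require Import complex.
Set Implicit Arguments. Unset Strict Implicit. Unset Printing Implicit Defensive.
Import Order.TTheory GRing.Theory Num.Theory.
Local Open Scope ring_scope.
Local Open Scope classical_set_scope.
Import numFieldNormedType.Exports.

(* A finite graph (multi-edges and loops allowed), Serre-style:
   a finite set of vertices, a finite set of directed edges, an origin map,
   and a fixed-point-free involution e |-> \bar e.  Each (undirected) edge
   gives the two mutually inverse directed edges e, \bar e (for a loop these
   are two distinct directed edges with the same origin and terminus). *)
Record graph := Graph {
  vert : finType;
  darc : finType;
  orig : darc -> vert;
  rev  : darc -> darc;
  revK : involutive rev;
  rev_neq : forall e, rev e != e }.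

Definition term (G : graph) (e : darc G) : vert G := orig (rev e).

Definition regular (q : nat) (G : graph) : Prop :=
  forall v : vert G, #|[set e : darc G | orig e == v]| = q.+1.

(* Adjacency matrix A_ab = #{e : o(e)=a, t(e)=b}; vertices are indexed by
   'I_#|V| through enum_val (the spectrum does not depend on this ordering). *)
Definition adjacency (K : pzRingType) (G : graph) : 'M[K]_#|vert G| :=
  \matrix_(i, j) (#|[set e : darc G | (orig e == enum_val i) &&
                                       (term e == enum_val j)]|)%:R.

(* Colored adjacency matrix A^sigma : N|V| x N|V| block matrix, rows/columns
   indexed by pairs (vertex, k) with k : 'I_N, enumerated via enum_val;
   block (a,b) is \sum_{e : o(e)=a, t(e)=b} sigma(e). *)
Definition colored_adjacency (K : pzRingType) (N : nat) (G : graph)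
    (sigma : darc G -> 'M[K]_N) : 'M[K]_#|{: vert G * 'I_N}| :=
  \matrix_(i, j)
    \sum_(e : darc G | (orig e == (enum_val i).1) && (term e == (enum_val j).1))
      sigma e (enum_val i).2 (enum_val j).2.

Definition unitary (R : rcfType) (N : nat) (M : 'M[R[i]]_N) : Prop :=
  M *m (map_mx (@conjc R) M)^T = 1%:M.

Definition unitary_subgroup (R : rcfType) (N : nat) (Gs : 'M[R[i]]_N -> Prop)
  : Prop :=
  [/\ forall M, Gs M -> unitary M,
      Gs 1%:M,
      forall M M', Gs M -> Gs M' -> Gs (M *m M')
    & forall M, Gs M -> Gs (invmx M)].

Definition is_color (R : rcfType) (N : nat) (Gs : 'M[R[i]]_N -> Prop)
    (G : graph) (sigma : darc G -> 'M[R[i]]_N) : Prop :=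
  forall e, Gs (sigma e) /\ sigma (rev e) = invmx (sigma e).

(* The eigenvalues (with multiplicity) of a self-adjoint complex matrix: the
   real numbers l_1..l_n with char_poly A = \prod_k ('X - l_k).
   (Chosen classically; [::] if no such real sequence exists, which never
   happens for the self-adjoint matrices considered here.) *)
Definition real_eigenvalues (R : rcfType) (n : nat) (A : 'M[R[i]]_n) : seq R :=
  match pselect (exists s : seq R,
                   char_poly A = \prod_(x <- s) ('X - ((x%:C)%C)%:P)) with
  | left h => proj1_sig (cid h)
  | right _ => [::]
  end.

(* A (finite) spectral measure is represented by its integration functional
   f |-> \int f d mu, for f : R -> R.
   mu(G) = 1/|V| \sum_k delta_{q^{-1/2} lambda_k(A)} *)
Definition mu_graph (R : realType) (q : nat) (G : graph) (f : R -> R) : R :=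
  (#|vert G|%:R)^-1 *
  \sum_(x <- real_eigenvalues (adjacency R[i] G)) f (x / Num.sqrt q%:R).

Definition mu_colored (R : realType) (q N : nat) (G : graph)
    (sigma : darc G -> 'M[R[i]]_N) (f : R -> R) : R :=
  ((N * #|vert G|)%:R)^-1 *
  \sum_(x <- real_eigenvalues (colored_adjacency sigma)) f (x / Num.sqrt q%:R).

Definition kesten_mckay_density (R : realType) (q : nat) (x : R) : R :=
  (q.+1%:R * Num.sqrt (4 - x ^+ 2)) /
  (2 * pi * (((Num.sqrt q%:R)^-1 + Num.sqrt q%:R) ^+ 2 - x ^+ 2)).

Definition kesten_mckay (R : realType) (q : nat) (f : R -> R) : R :=
  Rintegral lebesgue_measure `[(-2)%R, 2%R]
            (fun x => f x * kesten_mckay_density q x).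

Definition weakly_converges (R : realType) (mus : nat -> (R -> R) -> R)
    (mu : (R -> R) -> R) : Prop :=
  forall f : R -> R, continuous f -> (exists M : R, forall x, `|f x| <= M) ->
    (mus n f) @[n --> \oo] --> mu f.

(* Main.v *)
(** Let P_k be the polynomials for which P_k(A^sigma) is the sum of sigma over
    the nonbacktracking walks of length k.  Since unitary N x N matrices have
    trace at most N in modulus, the k-th nonbacktracking moment of mu(G, sigma)
    is bounded, for k >= 1, by that of mu(G), which is the number of closed
    nonbacktracking walks of length k divided by |V|; the two coincide for the
    trivial color.  The integral of P_k against the Kesten-McKay distribution
    vanishes for k >= 1, so if mu(G_n) converges to it then the nonbacktracking
    moments of mu(G_n) and of mu(G_n, sigma_n) tend to 0.  In both directions
    mu(G_n, sigma_n) - mu(G_n) thus tends to 0 on the P_k, which span all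
    polynomials, hence on continuous functions by Weierstrass, all eigenvalues
    lying in [-(q+1), q+1].

    For the integrals, P_k(sqrt q x) is a multiple of U_k - U_(k-2)/q, with U_k
    the Chebyshev polynomials on [-2, 2].  Writing c^2 - x^2 for the denominator
    of the density, orthogonality of U_k (k >= 1) to the semicircle weight gives
    int P_(k+2) = q int P_k after normalization, while the left-hand sides are
    bounded when q >= 2.  For q = 1 the integrand has the explicit primitive
    - U_(k-1) sqrt(4 - x^2) / k, up to a constant factor. *)

Require Import Defs.
From HB Require Import structures.
From mathcomp Require Import all_boot all_order all_algebra.
From mathcomp Require Import all_classical all_reals all_analysis.
From mathcomp Require Import complex.
From mathcomp Require Import measurable_realfun spectral sesquilinear ring lra.
Import Order.TTheory GRing.Theory Num.Theory.
Import numFieldNormedType.Exports.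
Local Open Scope ring_scope.
Set Implicit Arguments. Unset Strict Implicit. Unset Printing Implicit Defensive.

Local Notation rev := Defs.rev.
Local Notation term := Defs.term.

(** * Spectra of hermitian matrices *)

(** The sizes [m] and [n] need only be provably equal, as for the vertices and the pairs of a vertex
    with an element of ['I_1]. *)
Lemma char_poly_conj (K : comNzRingType) (m n : nat) (Q : 'M[K]_(m, n))
    (Q' : 'M[K]_(n, m)) (M : 'M[K]_n) :
  m = n -> Q *m Q' = 1%:M -> char_poly (Q *m M *m Q') = char_poly M.
Proof.
move=> mn; rewrite mn in Q Q' *.
rewrite /char_poly /char_poly_mx !map_mxM /= => QQ'.
set S := map_mx polyC Q; set S' := map_mx polyC Q'.
have SS' : S *m S' = 1%:M by rewrite /S /S' -map_mxM QQ' map_mx1.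
have -> : 'X%:M - S *m map_mx polyC M *m S'
    = S *m ('X%:M - map_mx polyC M) *m S'.
  by rewrite mulmxBr mulmxBl scalar_mxC -[X in _ = X - _]mulmxA SS' mulmx1.
by rewrite !det_mulmx mulrAC -det_mulmx SS' det1 mul1r.
Qed.

Section RealEigenvalues.
Variables (R : realType) (n : nat) (A : 'M[R[i]]_n).
Hypothesis A_herm : A \is hermsymmx.

Lemma char_poly_spectral :
  char_poly A = \prod_(i < n) ('X - (spectral_diag A 0 i)%:P).
Proof.
have /hermitian_normalmx/orthomx_spectralP AE := A_herm.
rewrite {1}AE char_poly_conj ?mulVmx ?spectral_unit //.
rewrite /char_poly /char_poly_mx map_diag_mx.
have -> : 'X%:M - diag_mx (map_mx polyC (spectral_diag A)) =
   diag_mx (\row_i ('X - (spectral_diag A 0 i)%:P)).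
  by apply/matrixP => i j; rewrite !mxE mulrnBl.
by rewrite det_diag; apply: eq_bigr => i _; rewrite mxE.
Qed.

Lemma spectral_diag_real i : ((complex.Re (spectral_diag A 0 i))%:C)%C = spectral_diag A 0 i.
Proof.
have /mxOverP/(_ 0 i) := hermitian_spectral_diag_real A_herm.
by move=> /complex_realP[x ->].
Qed.

(** The spectral diagonal of a hermitian matrix is real, so the default [[::]] is never taken. *)
Lemma real_eigenvalues_char_poly :
  char_poly A = \prod_(x <- real_eigenvalues A) ('X - ((x%:C)%C)%:P).
Proof.
rewrite /real_eigenvalues; case: pselect => [h|[]]; first by case: (cid h).
exists [seq complex.Re (spectral_diag A 0 i) | i <- enum 'I_n].
rewrite char_poly_spectral big_map big_enum.
by apply: eq_bigr => i _; rewrite spectral_diag_real.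
Qed.

Lemma sum_real_eigenvalues (f : R[i] -> R[i]) :
  \sum_(x <- real_eigenvalues A) f ((x%:C)%C)
  = \sum_(i < n) f (spectral_diag A 0 i).
Proof.
have := real_eigenvalues_char_poly; rewrite char_poly_spectral => /esym.
rewrite -(big_map (fun x : R => (x%:C)%C) xpredT (fun y => 'X - y%:P)).
have -> : \prod_(i < n) ('X - (spectral_diag A 0 i)%:P) =
    \prod_(y <- [seq spectral_diag A 0 i | i <- enum 'I_n]) ('X - y%:P).
  by rewrite big_map big_enum.
move/prod_XsubC_eq => eigs_perm.
rewrite -(big_map (fun x : R => (x%:C)%C) xpredT f) (perm_big _ eigs_perm) /=.
by rewrite big_map big_enum.
Qed.

Lemma real_eigenvalue_eigenvector x : x \in real_eigenvalues A ->
  exists2 v : 'rV[R[i]]_n, v *m A = (x%:C)%C *: v & v != 0.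
Proof.
move=> xA; apply/eigenvalueP; rewrite eigenvalue_root_char.
rewrite real_eigenvalues_char_poly.
rewrite -(big_map (fun x : R => (x%:C)%C) xpredT (fun y => 'X - y%:P)).
by rewrite root_prod_XsubC map_f.
Qed.

End RealEigenvalues.

(** The eigenvalue list is a classical choice, fixed by the characteristic polynomial only up to
    order. *)
Lemma perm_real_eigenvalues (R : realType) (m n : nat)
    (A : 'M[R[i]]_m) (B : 'M[R[i]]_n) :
  A \is hermsymmx -> B \is hermsymmx -> char_poly A = char_poly B ->
  perm_eq (real_eigenvalues A) (real_eigenvalues B).
Proof.
move=> Ah Bh; rewrite !real_eigenvalues_char_poly //.
rewrite -2!(big_map (fun x : R => (x%:C)%C) xpredT (fun y => 'X - y%:P)).
move/prod_XsubC_eq; apply: perm_map_inj; exact: complexI.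
Qed.

(* The coefficient is [q.+1] at the first step because the start vertex has
   [q.+1] edges along which a walk of length 2 can backtrack. *)
Fixpoint nbpoly (K : comNzRingType) (q k : nat) : {poly K} :=
  match k with
  | 0 => 1
  | k1.+1 => match k1 with
    | 0 => 'X
    | k2.+1 => 'X * nbpoly K q k1 - (q + (k2 == 0%N))%:R *: nbpoly K q k2
    end
  end.

Lemma nbpolySS (K : comNzRingType) (q k : nat) :
  nbpoly K q k.+2 =
  'X * nbpoly K q k.+1 - (q + (k == 0%N))%:R *: nbpoly K q k.
Proof. by []. Qed.

Lemma horner_nbpoly_complex (R : rcfType) (q k : nat) (x : R) :
  (nbpoly R[i] q k).[(x%:C)%C] = ((nbpoly R q k).[x]%:C)%C.
Proof.
(* The recurrence has order two, so the induction carries two consecutive indices. *)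
suff H j : (nbpoly R[i] q j).[(x%:C)%C] = ((nbpoly R q j).[x]%:C)%C /\
  (nbpoly R[i] q j.+1).[(x%:C)%C] = ((nbpoly R q j.+1).[x]%:C)%C by case: (H k).
elim: j => [|j [IH1 IH2]]; first by rewrite /= !hornerE.
split => //; rewrite !nbpolySS !hornerE IH1 IH2 rmorphB !rmorphM /=.
by rewrite rmorph_nat.
Qed.

(** The recurrence forces [B k] to be the polynomial [nbpoly q k] of [A], which is diagonal in an
    eigenbasis of [A]. *)
Lemma tr_nb_recurrence (R : realType) (q n : nat) (A : 'M[R[i]]_n)
    (B : nat -> 'M[R[i]]_n) :
  A \is hermsymmx -> B 0 = 1%:M -> B 1 = A ->
  (forall k, B k.+2 = A *m B k.+1 - (q + (k == 0%N))%:R *: B k) ->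
  forall k, \tr (B k) =
    ((\sum_(x <- real_eigenvalues A) (nbpoly R q k).[x])%:C)%C.
Proof.
move=> Ah B0 B1 BS k.
have /hermitian_normalmx/orthomx_spectralP := Ah.
set P := spectralmx A; set d := spectral_diag A => AE.
have uP : P \in unitmx by exact: spectral_unit.
pose D k : 'M[R[i]]_n := diag_mx (map_mx (fun y => (nbpoly R[i] q k).[y]) d).
have D0 : D 0 = 1%:M by apply/matrixP => i j; rewrite !mxE /= hornerE.
have D1 : D 1 = diag_mx d by apply/matrixP => i j; rewrite !mxE /= hornerE.
have DS j : D j.+2 = diag_mx d *m D j.+1 - (q + (j == 0%N))%:R *: D j.
  rewrite /D mulmx_diag; apply/matrixP => a b; rewrite !mxE nbpolySS !hornerE.
  by case: (a == b); rewrite ?mulr1n // !mulr0n mulr0 subrr.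
have BD j : B j = invmx P *m D j *m P /\ B j.+1 = invmx P *m D j.+1 *m P.
  elim: j => [|j [IH1 IH2]].
    split; first by rewrite B0 D0 mulmx1 mulVmx.
    by rewrite B1 D1; exact: AE.
  split; first exact: IH2.
  rewrite BS IH1 IH2 AE DS mulmxBr mulmxBl -scalemxAr -scalemxAl.
  by rewrite !mulmxA (mulmxK uP).
rewrite (BD k).1 mxtrace_mulC mulmxA mulmxV // mul1mx mxtrace_diag.
under eq_bigr do rewrite mxE.
rewrite -(sum_real_eigenvalues Ah (fun y => (nbpoly R[i] q k).[y])).
by rewrite rmorph_sum /=; apply: eq_bigr => x _; rewrite horner_nbpoly_complex.
Qed.

(** * Nonbacktracking walks with colors *)

Section BlockMatrices.
Variables (K : comNzRingType) (V : finType) (N : nat).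
Implicit Types M : V -> V -> 'M[K]_N.

Definition block_matrix M : 'M[K]_#|{: V * 'I_N}| :=
  \matrix_(i, j) M (enum_val i).1 (enum_val j).1 (enum_val i).2 (enum_val j).2.

Lemma sum_enum_val_pair (F : V * 'I_N -> K) :
  \sum_(i < #|{: V * 'I_N}|) F (enum_val i) = \sum_a \sum_k F (a, k).
Proof.
rewrite pair_big /= [RHS](reindex (@enum_val _ {: V * 'I_N})) /=.
  by apply: eq_bigr => i _; case: (enum_val i).
exact: onW_bij (enum_val_bij _).
Qed.

Lemma block_matrixM M M' :
  block_matrix M *m block_matrix M' =
  block_matrix (fun a b => \sum_c M a c *m M' c b).
Proof.
apply/matrixP => i j; rewrite !mxE.
under eq_bigr do rewrite !mxE.
rewrite (sum_enum_val_pair (fun p => M (enum_val i).1 p.1 (enum_val i).2 p.2 *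
  M' p.1 (enum_val j).1 p.2 (enum_val j).2)) /=.
by rewrite summxE; apply: eq_bigr => c _; rewrite mxE.
Qed.

Lemma block_matrix1 :
  block_matrix (fun a b => if a == b then 1%:M else 0) = 1%:M.
Proof.
apply/matrixP => i j; rewrite !mxE -(inj_eq enum_val_inj).
case: (enum_val i) (enum_val j) => [a k] [b l] /=.
by rewrite -[(a, k) == _]/((a == b) && (k == l)); case: (a == b); rewrite mxE.
Qed.

Lemma tr_block_matrix M : \tr (block_matrix M) = \sum_a \tr (M a a).
Proof.
rewrite /mxtrace; under eq_bigr do rewrite mxE.
exact: (sum_enum_val_pair (fun p => M p.1 p.1 p.2 p.2)).
Qed.

End BlockMatrices.

Section NonbacktrackingWalks.
Variables (K : comNzRingType) (G : graph) (q N : nat).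
Variable sigma : darc G -> 'M[K]_N.
Hypothesis G_regular : regular q G.
Hypothesis sigma_rev : forall e, sigma e *m sigma (rev e) = 1%:M.

Definition adjacency_block (a b : vert G) : 'M[K]_N :=
  \sum_(e : darc G | (orig e == a) && (term e == b)) sigma e.

Lemma colored_adjacencyE : colored_adjacency sigma = block_matrix adjacency_block.
Proof. by apply/matrixP => i j; rewrite !mxE summxE. Qed.

(* The sum of the products of [sigma] along the nonbacktracking walks with
   [k.+1] edges, first edge [e] and end point [b]. *)
Fixpoint nbwalk (k : nat) (e : darc G) (b : vert G) : 'M[K]_N :=
  if k is k'.+1 then
    sigma e *m \sum_(f | (orig f == term e) && (f != rev e)) nbwalk k' f b
  else if term e == b then sigma e else 0.

(** The blocks of P_k(A^sigma): walks with exactly [k] edges, hence the shift against [nbwalk]. *)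
Definition nbblock (k : nat) (a b : vert G) : 'M[K]_N :=
  if k is k'.+1 then \sum_(e | orig e == a) nbwalk k' e b
  else if a == b then 1%:M else 0.

Lemma term_rev (e : darc G) : term (rev e) = orig e.
Proof. by rewrite /term Defs.revK. Qed.

Lemma card_orig (a : vert G) : #|[pred e : darc G | orig e == a]| = q.+1.
Proof.
rewrite -(G_regular a); apply: eq_card => e; rewrite inE.
by apply/idP/idP; rewrite in_setE.
Qed.

(** The terms are walks that follow [e] and return at once. Deleting these two steps leaves a walk
    from [a] with some first edge [f]; then [e] is any edge at [a] other than [f], which gives [q]
    choices, or [q.+1] when nothing is left. *)
Lemma nbwalk_cancel k a b :
  \sum_(e | orig e == a) sigma e *m nbwalk k (rev e) b
  = (q + (k == 0%N))%:R *: nbblock k a b.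
Proof.
case: k => [|k] /=.
  transitivity (\sum_(e : darc G | orig e == a)
                  (if a == b then 1%:M else 0 : 'M[K]_N)).
    apply: eq_bigr => e /eqP <-; rewrite term_rev.
    by case: eqP => // _; rewrite mulmx0.
  by rewrite sumr_const card_orig addn1 scaler_nat.
transitivity (\sum_(e | orig e == a) \sum_(f | (orig f == a) && (f != e)) nbwalk k f b).
  apply: eq_bigr => e /eqP oe; rewrite mulmxA sigma_rev mul1mx.
  by rewrite term_rev Defs.revK oe.
rewrite (exchange_big_dep (fun f => orig f == a)) /=; last by move=> e f _ /andP[].
rewrite addn0 scaler_sumr; apply: eq_bigr => f of_.
rewrite sumr_const scaler_nat; congr (_ *+ _).
apply/succn_inj; rewrite -(card_orig a) [RHS](cardD1 f) inE of_ add1n.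
by congr S; apply: eq_card => e; rewrite !inE /= [LHS]andbC eq_sym.
Qed.

Lemma nbblock1 : nbblock 1 = adjacency_block.
Proof.
apply/funext => a; apply/funext => b /=.
by rewrite /adjacency_block big_mkcondr.
Qed.

(** Prefix an arbitrary edge to a nonbacktracking walk with [k.+1] edges: either the result is
    nonbacktracking, or its second edge reverses the first and [nbwalk_cancel] counts it. *)
Lemma nbblockSS k a b :
  nbblock k.+2 a b = \sum_c adjacency_block a c *m nbblock k.+1 c b
     - (q + (k == 0%N))%:R *: nbblock k a b.
Proof.
apply/eqP; rewrite eq_sym subr_eq -nbwalk_cancel; apply/eqP => /=.
rewrite -big_split /=.
transitivity (\sum_(e | orig e == a)
   sigma e *m \sum_(f | orig f == term e) nbwalk k f b).
  under eq_bigr do rewrite /adjacency_block mulmx_suml.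
  rewrite (exchange_big_dep (fun e => orig e == a)) /=; last by move=> c e _ /andP[].
  apply: eq_bigr => e oe; rewrite (big_pred1 (term e)) // => c.
  by rewrite oe eq_sym.
apply: eq_bigr => e _; rewrite (bigD1 (rev e)) //=.
by rewrite mulmxDr addrC.
Qed.

End NonbacktrackingWalks.

Fixpoint nbcount_from (G : graph) (k : nat) (e : darc G) (b : vert G) : nat :=
  if k is k'.+1 then
    \sum_(f | (orig f == term e) && (f != rev e)) nbcount_from k' f b
  else (term e == b).

(** These walks have [k.+1] edges. Closed means only that the end points agree: the last edge may
    reverse the first. *)
Definition nbcount (G : graph) (k : nat) : nat :=
  \sum_(a : vert G) \sum_(e | orig e == a) nbcount_from k e a.

Lemma nbwalk1 (K : comNzRingType) (G : graph) (N k : nat) e b :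
  nbwalk (fun _ : darc G => 1%:M : 'M[K]_N) k e b = (nbcount_from k e b)%:R%:M.
Proof.
elim: k e b => [|k IH] e b /=; first by case: eqP => //; rewrite raddf0.
by rewrite mul1mx natr_sum raddf_sum /=; apply: eq_bigr => f _; exact: IH.
Qed.

Lemma normc_real (R : rcfType) (x : R) : `|(x%:C)%C| = (`|x|%:C)%C.
Proof. by rewrite normc_def /= expr0n addr0 sqrtr_sqr. Qed.

(** * Unitary matrices and their traces *)

Section Unitary.
Variables (R : realType) (N : nat).
Implicit Types U : 'M[R[i]]_N.

Lemma unitary_row_norm U k : unitary U -> \sum_l `|U k l| ^+ 2 = 1.
Proof.
move=> /matrixP/(_ k k); rewrite !mxE eqxx mulr1n; apply: etrans.
by apply: eq_bigr => l _; rewrite !mxE normCK.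
Qed.

(** A diagonal entry is bounded by the norm of its row, which is 1. *)
Lemma unitary_trace_le U : unitary U -> `|\tr U| <= N%:R.
Proof.
move=> uU; apply: le_trans (ler_norm_sum _ _ _) _.
rewrite -[X in X%:R]card_ord -sum1_card natr_sum; apply: ler_sum => k _.
rewrite -(@expr_le1 _ 2) // -(unitary_row_norm k uU) (bigD1 k) //=.
by rewrite lerDl sumr_ge0 // => l _; rewrite exprn_ge0.
Qed.

Lemma unitaryM U W : unitary U -> unitary W -> unitary (U *m W).
Proof.
rewrite /unitary => uU uW.
by rewrite map_mxM trmx_mul mulmxA -(mulmxA U) uW mulmx1.
Qed.

Lemma unitary1 : unitary (1%:M : 'M[R[i]]_N).
Proof. by rewrite /unitary map_mx1 trmx1 mulmx1. Qed.

Lemma unitary_unitmx U : unitary U -> U \in unitmx.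
Proof. by case/mulmx1_unit. Qed.

Lemma unitary_inv U : unitary U -> invmx U = (map_mx (@conjc R) U)^T.
Proof.
move=> uU; apply: (can_inj (mulKmx (unitary_unitmx uU))).
by rewrite uU mulmxV // unitary_unitmx.
Qed.

End Unitary.

(** * Spectrum of a graph with a unitary color *)

Section UnitaryColor.
Variables (R : realType) (G : graph) (q N : nat).
Variable sigma : darc G -> 'M[R[i]]_N.
Hypothesis G_regular : regular q G.
Hypothesis sigma_color : is_color (@unitary R N) sigma.

Let uS e : unitary (sigma e). Proof. by case: (sigma_color e). Qed.

Let sigma_revE e : sigma (rev e) = (map_mx (@conjc R) (sigma e))^T.
Proof. by have [_ ->] := sigma_color e; rewrite unitary_inv. Qed.

Let sigma_rev e : sigma e *m sigma (rev e) = 1%:M.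
Proof. by rewrite sigma_revE; exact: uS. Qed.

(** Reversing edges exchanges origin and terminus and turns [sigma e] into its conjugate
    transpose. *)
Lemma colored_adjacency_herm : colored_adjacency sigma \is hermsymmx.
Proof.
apply/is_hermitianmxP; rewrite expr0 scale1r; apply/matrixP => i j.
rewrite !mxE rmorph_sum /= (reindex_inj (can_inj (@Defs.revK G))) /=.
apply: eq_big => [e|e _]; first by rewrite term_rev andbC.
by rewrite sigma_revE !mxE.
Qed.

(** The factor [U] absorbs the edges already traversed, so that the induction along the walk goes
    through. *)
Lemma tr_nbwalk_le (U : 'M[R[i]]_N) k e b : unitary U ->
  `|\tr (U *m nbwalk sigma k e b)| <= (N * nbcount_from k e b)%:R.
Proof.
elim: k U e b => [|k IH] U e b uU /=.
  case: eqP => _; last by rewrite mulmx0 mxtrace0 normr0 muln0.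
  by rewrite muln1; apply: unitary_trace_le; exact: unitaryM.
rewrite mulmxA mulmx_sumr raddf_sum /= big_distrr /= natr_sum.
apply: le_trans (ler_norm_sum _ _ _) (ler_sum _ _) => f _.
by apply: IH; exact: unitaryM.
Qed.

Lemma sum_nbpoly_eigenvalues k :
  ((\sum_(x <- real_eigenvalues (colored_adjacency sigma))
      (nbpoly R q k).[x])%:C)%C = \sum_a \tr (nbblock sigma k a a).
Proof.
rewrite -tr_block_matrix.
apply/esym/(tr_nb_recurrence (B := fun k => block_matrix (nbblock sigma k))).
- exact: colored_adjacency_herm.
- exact: block_matrix1.
- by rewrite nbblock1 colored_adjacencyE.
move=> j; rewrite colored_adjacencyE block_matrixM.
by apply/matrixP => i l; rewrite !mxE (nbblockSS G_regular sigma_rev) !mxE.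
Qed.

Lemma sum_nbpoly_eigenvalues_le k :
  `|\sum_(x <- real_eigenvalues (colored_adjacency sigma))
      (nbpoly R q k.+1).[x]| <= (N * nbcount G k)%:R.
Proof.
rewrite -lecR -normc_real sum_nbpoly_eigenvalues rmorph_nat /=.
rewrite /nbcount big_distrr natr_sum.
apply: le_trans (ler_norm_sum _ _ _) (ler_sum _ _) => a _ /=.
rewrite raddf_sum big_distrr natr_sum.
apply: le_trans (ler_norm_sum _ _ _) (ler_sum _ _) => e _ /=.
by rewrite -[X in \tr X]mul1mx; apply: tr_nbwalk_le; exact: unitary1.
Qed.

(** The trace formula at [k = 0], where [nbpoly] is 1, counts the eigenvalues. *)
Lemma size_eigenvalues :
  size (real_eigenvalues (colored_adjacency sigma)) = (N * #|vert G|)%N.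
Proof.
apply/eqP; rewrite -(eqr_nat R[i]); apply/eqP.
transitivity (((\sum_(x <- real_eigenvalues (colored_adjacency sigma))
  (nbpoly R q 0).[x])%:C)%C).
  under eq_bigr do rewrite hornerC.
  by rewrite big_const_seq count_predT iter_addr_0 rmorphMn rmorph1.
rewrite sum_nbpoly_eigenvalues; under eq_bigr do rewrite /= eqxx mxtrace1.
by rewrite sumr_const natrM mulr_natr.
Qed.

(* If [v] is an eigenvector and [y_e] is the image of [v_(orig e)] under
   [sigma e], then [x |v|^2 = \sum_e <y_e, v_(term e)>] and [|y_e| = |v_(orig e)|];
   conclude by AM-GM on each edge. *)
Lemma eigenvalue_le x :
  x \in real_eigenvalues (colored_adjacency sigma) -> `|x| <= q.+1%:R.
Proof.
move=> /(real_eigenvalue_eigenvector colored_adjacency_herm)[v vA v0].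
pose u (p : vert G * 'I_N) := v 0 (enum_rank p).
have vE i : v 0 i = u (enum_val i) by rewrite /u enum_valK.
pose nv a := \sum_k `|u (a, k)| ^+ 2.
pose y e l := \sum_k u (orig e, k) * sigma e k l.
have ny e : \sum_l `|y e l| ^+ 2 = nv (orig e).
  have conjTE (w : 'rV[R[i]]_N) l : (map_mx (@conjc R) w)^T l 0 = (w 0 l)^*.
    by rewrite !mxE.
  have UU' : sigma e *m (map_mx (@conjc R) (sigma e))^T = 1%:M by exact: uS.
  pose r : 'rV_N := \row_k u (orig e, k).
  transitivity ((r *m sigma e *m (map_mx (@conjc R) (r *m sigma e))^T) 0 0).
    rewrite mxE; apply: eq_bigr => l _; rewrite normCK.
    have -> : y e l = (r *m sigma e) 0 l.
      by rewrite mxE; apply: eq_bigr => k _; rewrite mxE.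
    by rewrite conjTE.
  rewrite map_mxM trmx_mul mulmxA -(mulmxA r) UU' mulmx1 mxE.
  by apply: eq_bigr => k _; rewrite !mxE normCK.
pose S := \sum_a nv a.
have SE : S = \sum_i `|v 0 i| ^+ 2.
  under [RHS]eq_bigr do rewrite vE.
  by rewrite (sum_enum_val_pair (fun p => `|u p| ^+ 2)).
have S0 : 0 < S.
  rewrite SE lt_neqAle sumr_ge0 ?andbT; last by move=> i _; rewrite exprn_ge0.
  apply: contra v0; rewrite eq_sym psumr_eq0; last by move=> i _; rewrite exprn_ge0.
  move=> /allP v0; apply/eqP/rowP => i; rewrite mxE.
  by have := v0 i (mem_index_enum _); rewrite /= expf_eq0 normr_eq0 => /eqP.
(* The quadratic form of A^sigma at [v], regrouped from pairs of indices into edges. *)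
have xS : (x%:C)%C * S = \sum_e \sum_l y e l * (u (term e, l))^*.
  rewrite SE mulr_sumr.
  under eq_bigr => j _.
    rewrite normCK mulrA.
    have -> : (x%:C)%C * v 0 j = (v *m colored_adjacency sigma) 0 j.
      by rewrite vA mxE.
    rewrite colored_adjacencyE mxE mulr_suml.
    under eq_bigr do rewrite mxE !vE.
    rewrite (sum_enum_val_pair (fun p => u p * adjacency_block sigma p.1
      (enum_val j).1 p.2 (enum_val j).2 * (u (enum_val j))^*)).
    over.
  rewrite (sum_enum_val_pair (fun p => \sum_a \sum_k u (a, k) *
     adjacency_block sigma a p.1 k p.2 * (u p)^*)) /=.
  rewrite [RHS](partition_big (fun e => term e) xpredT) //=.
  apply: eq_bigr => b _; rewrite [RHS]exchange_big /=; apply: eq_bigr => l _.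
  rewrite [RHS](partition_big (fun e => orig e) xpredT) //=.
  apply: eq_bigr => a _.
  transitivity (\sum_k \sum_(e | (term e == b) && (orig e == a))
       u (orig e, k) * sigma e k l * (u (term e, l))^*).
    apply: eq_bigr => k _; rewrite summxE mulr_sumr mulr_suml.
    rewrite (eq_bigl _ _ (fun e => andbC _ _)).
    by apply: eq_bigr => e /andP[/eqP <- /eqP <-].
  rewrite exchange_big /=; apply: eq_bigr => e _.
  by rewrite /y mulr_suml.
have sum_orig : \sum_e nv (orig e) = q.+1%:R * S.
  rewrite (partition_big (fun e => orig e) xpredT) //= mulr_sumr.
  apply: eq_bigr => a _.
  under eq_bigr => e /eqP -> do [].
  by rewrite sumr_const (card_orig G_regular) mulr_natl.
have sum_term : \sum_e nv (term e) = q.+1%:R * S.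
  rewrite -sum_orig (reindex_inj (can_inj (@Defs.revK G))) /=.
  by apply: eq_bigr => e _; rewrite term_rev.
rewrite -lecR -normc_real -(ler_pM2r S0) rmorph_nat -[in leLHS](ger0_norm (ltW S0)).
rewrite -normrM xS.
have amgm (a b : R[i]) : `|a * b^*| <= (`|a| ^+ 2 + `|b| ^+ 2) / 2.
  rewrite normrM norm_conjC ler_pdivlMr ?ltr0n // -subr_ge0.
  have -> : `|a| ^+ 2 + `|b| ^+ 2 - `|a| * `|b| * 2 = (`|a| - `|b|) ^+ 2 by ring.
  by rewrite real_exprn_even_ge0 // rpredB // ?normr_real.
apply: (@le_trans _ _ (\sum_e \sum_l
    ((`|y e l| ^+ 2 + `|u (term e, l)| ^+ 2) / 2))).
  apply: le_trans (ler_norm_sum _ _ _) (ler_sum _ _) => e _.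
  by apply: le_trans (ler_norm_sum _ _ _) (ler_sum _ _) => l _.
under eq_bigr do rewrite -mulr_suml big_split /= ny -/(nv _).
rewrite -mulr_suml big_split /= sum_orig sum_term.
by rewrite mulrDl -splitr.
Qed.

End UnitaryColor.

(** * The trivial color *)

Section TrivialColor.
Variables (R : realType) (G : graph) (q : nat).
Hypothesis G_regular : regular q G.

Lemma trivial_color (N : nat) :
  is_color (@unitary R N) (fun _ : darc G => 1%:M).
Proof. by move=> e; rewrite invmx1; split => //; exact: unitary1. Qed.

(** Every walk contributes the identity, of trace [N], so the bound for unitary colors is
    attained. *)
Lemma sum_nbpoly_trivial_color (N k : nat) :
  \sum_(x <- real_eigenvalues (colored_adjacency
      (fun _ : darc G => 1%:M : 'M[R[i]]_N))) (nbpoly R q k.+1).[x]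
  = (N * nbcount G k)%:R.
Proof.
apply: complexI; rewrite (sum_nbpoly_eigenvalues G_regular (@trivial_color N)).
rewrite /nbcount big_distrr rmorph_nat natr_sum; apply: eq_bigr => a _.
rewrite raddf_sum big_distrr natr_sum; apply: eq_bigr => e _ /=.
by rewrite nbwalk1 mxtrace_scalar natrM mulr_natl.
Qed.

Lemma adjacencyE (i j : 'I_#|vert G|) : adjacency R[i] G i j =
  \sum_(e : darc G | (orig e == enum_val i) && (term e == enum_val j)) 1.
Proof.
rewrite mxE sumr_const; congr (_%:R); apply: eq_card => e.
by rewrite [RHS]inE; apply/idP/idP; rewrite in_setE.
Qed.

Lemma adjacency_herm : adjacency R[i] G \is hermsymmx.
Proof.
apply/is_hermitianmxP; rewrite expr0 scale1r; apply/matrixP => i j.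
rewrite [RHS]mxE [in RHS]mxE !adjacencyE rmorph_sum /=.
rewrite (reindex_inj (can_inj (@Defs.revK G))) /=.
apply: eq_big => [e|e _]; first by rewrite term_rev andbC.
by rewrite rmorph1.
Qed.

(** This lets mu(G) be treated as the spectral measure of a color with [N = 1]. *)
Lemma mu_graph_trivial_color :
  mu_graph (R := R) q G = mu_colored q (fun _ : darc G => 1%:M : 'M[R[i]]_1).
Proof.
apply/funext => f; rewrite /mu_graph /mu_colored mul1n; congr (_ * _).
apply/perm_big/perm_real_eigenvalues.
- exact: adjacency_herm.
- exact: (colored_adjacency_herm (@trivial_color 1)).
(* The permutation matrix that matches the two enumerations of the vertices. *)
pose Q : 'M[R[i]]_(#|vert G|, #|{: vert G * 'I_1}|) :=
  \matrix_(i, j) (enum_val i == (enum_val j).1)%:R.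
have QQ : Q *m Q^T = 1%:M.
  apply/matrixP => i j; rewrite !mxE.
  under eq_bigr do rewrite !mxE.
  rewrite (sum_enum_val_pair
    (fun p => (enum_val i == p.1)%:R * (enum_val j == p.1)%:R)) /=.
  under eq_bigr do rewrite big_ord1.
  rewrite (bigD1 (enum_val i)) //= eqxx mul1r big1 ?addr0 => [|a /negbTE ai].
    by rewrite (inj_eq enum_val_inj) eq_sym.
  by rewrite eq_sym ai mul0r.
set A1 := colored_adjacency _.
transitivity (char_poly (Q *m A1 *m Q^T)); last first.
  by apply: char_poly_conj => //; rewrite card_prod card_ord muln1.
congr char_poly.
suff -> : Q *m A1 = adjacency R[i] G *m Q.
  by rewrite -mulmxA QQ mulmx1.
apply/matrixP => i l; rewrite /A1 colored_adjacencyE mxE [RHS]mxE.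
under eq_bigr do rewrite !mxE.
rewrite (sum_enum_val_pair (fun p => (enum_val i == p.1)%:R *
  adjacency_block (fun=> 1%:M) p.1 (enum_val l).1 p.2 (enum_val l).2)) /=.
under eq_bigr do rewrite big_ord1.
rewrite (bigD1 (enum_val i)) //= eqxx mul1r big1 ?addr0 => [|a /negbTE ai]; last first.
  by rewrite eq_sym ai mul0r.
rewrite (bigD1 (enum_rank (enum_val l).1)) //= big1 ?addr0 => [|j jl]; last first.
  rewrite [Q _ _]mxE (_ : (_ == _) = false) ?mulr0 //; apply: contraNF jl => /eqP <-.
  by rewrite enum_valK.
rewrite adjacencyE mxE enum_rankK eqxx mulr1 summxE; apply: eq_bigr => e _.
by rewrite !ord1 mxE.
Qed.

End TrivialColor.

(** * Weierstrass approximation and empirical means *)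

Section Weierstrass.
Local Open Scope classical_set_scope.
Variable R : realType.
Implicit Types (f : R -> R) (g : nat -> R).

(* The expectation of [g] under the binomial law with parameters [n] and ['X]. *)
Fixpoint bernstein (n : nat) g : {poly R} :=
  if n is n'.+1 then
    'X * bernstein n' (fun k => g k.+1) + (1 - 'X) * bernstein n' g
  else (g 0%N)%:P.

(** On [0, 1] each recursion step is a convex combination. *)
Lemma bernstein_le n g h x : 0 <= x <= 1 ->
  (forall k, (k <= n)%N -> g k <= h k) ->
  (bernstein n g).[x] <= (bernstein n h).[x].
Proof.
move=> /andP[x0 x1]; elim: n g h => [|n IH] g h gh /=.
  by rewrite !hornerE gh.
rewrite !hornerE; apply: lerD; apply: ler_wpM2l; rewrite ?subr_ge0 //.
  by apply: IH => k kn; apply: gh.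
by apply: IH => k kn; apply: gh; exact: leqW.
Qed.

(** The binomial mean of a squared distance is variance plus squared bias. The shift of [g] in the
    recursion replaces [c] by [c - 1]. *)
Lemma bernstein_quadratic n g a K c x :
  (forall k, g k = a + K * (k%:R - c) ^+ 2) ->
  (bernstein n g).[x] = a + K * (n%:R * (x * (1 - x)) + (n%:R * x - c) ^+ 2).
Proof.
elim: n g c => [|n IH] g c gE /=; first by rewrite hornerC gE; ring.
rewrite !(hornerD, hornerM, hornerX, hornerN, hornerC) (IH g c gE) (IH (fun k => g k.+1) (c - 1)) => [|k].
  by rewrite -[n.+1%:R]natr1; ring.
by rewrite gE -[k.+1%:R]natr1; ring.
Qed.

(** Near the diagonal continuity gives [eps]; away from it [f] is bounded, and a large multiple of
    the squared distance dominates. *)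
Lemma continuous_quadratic_modulus f (B eps : R) :
  continuous f -> 0 < B -> 0 < eps -> exists K, forall u x,
  `|u| <= B -> `|x| <= B -> `|f u - f x| <= eps + K * (u - x) ^+ 2.
Proof.
move=> cf B0 eps0.
have [M fM] : exists M, forall u, `|u| <= B -> `|f u| <= M.
  have BB : - B <= B by lra.
  have cfB : {within `[- B, B], continuous f}.
    exact: continuous_subspaceT.
  have [c1 _ h1] := EVT_max BB cfB; have [c2 _ h2] := EVT_min BB cfB.
  exists (`|f c1| + `|f c2|) => u; rewrite ler_norml => uB.
  have := h1 u; have := h2 u; rewrite in_itv /= uB => /(_ isT) + /(_ isT).
  have := ler_norm (f c1); have := ler_norm (- f c2); rewrite normrN.
  have := normr_ge0 (f c1); have := normr_ge0 (f c2).
  by rewrite ler_norml; lra.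
(* Compactness, with [K] tending to infinity, makes one [K] serve all [x]. *)
have /compact_near_coveringP/near_covering_withinP := @segment_compact R (- B) B.
move=> /(_ R +oo (fun K x => forall u, `|u| <= B -> `|f u - f x| <= eps + K * (u - x) ^+ 2)).
case.
  move=> x xB.
  have /cvgrPdist_lt/(_ (eps / 2)) := cf x.
  rewrite divr_gt0 // => /(_ isT) /nbhs_ballP[d /= d0 fd].
  have M0 : 0 <= M.
    by apply: le_trans (normr_ge0 _) (fM 0 _); rewrite normr0 ltW.
  (* When [u] is at distance at least [d] from [x], it is at least d/2 away from [x'], and such a
     [K] gives K (d/2)^2 >= 2M, which bounds |f u - f x'|. *)
  exists (ball x (d / 2), [set K | 8 * M / d ^+ 2 < K]).
    split => /=; first by apply: nbhsx_ballx; rewrite divr_gt0.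
    by apply: nbhs_pinfty_gt; rewrite num_real.
  move=> [x' K] /= [xx' KM] x'B u uB.
  have K0 : 0 <= K by apply: le_trans (ltW KM); rewrite divr_ge0 ?exprn_ge0 ?mulr_ge0 // ltW.
  have fx' : `|f x - f x'| < eps / 2.
    apply: fd; move: xx'; rewrite /ball /= => h; apply: lt_trans h _; lra.
  have [ud|ud] := ltP `|x - u| d.
    have fu : `|f x - f u| < eps / 2 by exact: fd.
    have : 0 <= K * (u - x') ^+ 2 by rewrite mulr_ge0 ?sqr_ge0.
    have -> : f u - f x' = (f x - f x') - (f x - f u) by ring.
    by have := ler_normB (f x - f x') (f x - f u); lra.
  have uxd : d / 2 <= `|u - x'|.
    have := ler_normD (x - x') (x' - u); rewrite addrA subrK (distrC x' u).
    by move: xx'; rewrite /ball /=; lra.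
  have : d ^+ 2 / 4 <= (u - x') ^+ 2.
    rewrite -(real_normK (num_real (u - x'))).
    have -> : d ^+ 2 / 4 = (d / 2) ^+ 2 by field.
    by rewrite ler_pXn2r // nnegrE // ltW // divr_gt0.
  move=> /(ler_wpM2l K0) h1.
  have : 2 * M <= K * (d ^+ 2 / 4).
    have : 8 * M / d ^+ 2 * (d ^+ 2 / 4) <= K * (d ^+ 2 / 4).
      by rewrite ler_wpM2r ?(ltW KM) // divr_ge0 ?sqr_ge0.
    by rewrite (_ : 8 * M / _ * _ = 2 * M) //; field; rewrite gt_eqF.
  have := ler_normB (f u) (f x'); have := fM u uB; have := fM x'.
  rewrite ler_norml; move: x'B; rewrite /= in_itv /= => -> /(_ isT); lra.
move=> K0 [_ hK]; exists (K0 + 1) => u x uB xB.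
apply: (hK (K0 + 1)) => //=; first by rewrite ltrDl.
by rewrite in_itv /= -ler_norml.
Qed.

(** Bernstein's proof on [-B, B]: the sampled values lie between two parabolas, whose binomial means
    are explicit. *)
Lemma weierstrass f (B eps : R) : continuous f -> 0 < B -> 0 < eps ->
  exists p : {poly R}, forall x, `|x| <= B -> `|f x - p.[x]| <= eps.
Proof.
move=> cf B0 eps0.
have e20 : 0 < eps / 2 by rewrite divr_gt0.
have [K fK] := continuous_quadratic_modulus cf B0 e20.
pose L := `|K| * (2 * B) ^+ 2.
have L0 : 0 <= L by rewrite mulr_ge0 // sqr_ge0.
(* The variance contributes L t (1 - t) / n, at most [eps / 2] for this [n]. *)
have [n [n0 nL]] : exists n : nat, (0 < n)%N /\ L / n%:R <= eps / 2.
  exists (Num.trunc (L / (eps / 2))).+1; split => //.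
  rewrite ler_pdivrMr ?ltr0n // mulrC -ler_pdivrMr //.
  by apply/ltW/truncnS_gt.
pose g k := f (2 * B * (k%:R / n%:R) - B).
have nn0 : n%:R != 0 :> R by rewrite pnatr_eq0 -lt0n.
exists (bernstein n g \Po ((2 * B)^-1 *: ('X + B%:P))) => x xB.
have B20 : 0 < 2 * B by rewrite mulr_gt0.
rewrite horner_comp !hornerE; set t := (2 * B)^-1 * (x + B).
have xE : x = 2 * B * t - B by rewrite /t; field; rewrite gt_eqF.
have t01 : 0 <= t <= 1.
  move: xB; rewrite ler_norml /t => /andP[xB1 xB2].
  rewrite mulr_ge0 ?invr_ge0 ?(ltW B20) //=; last lra.
  by rewrite mulrC ler_pdivrMr // mul1r; lra.
have gK k : (k <= n)%N ->
    `|g k - f x| <= eps / 2 + (L / n%:R ^+ 2) * (k%:R - n%:R * t) ^+ 2.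
  move=> kn.
  have k01 : 0 <= (k%:R / n%:R : R) <= 1.
    by rewrite divr_ge0 //= ler_pdivrMr ?ltr0n // mul1r ler_nat.
  apply: le_trans (fK _ x _ xB) _.
    rewrite ler_norml; move: k01 => /andP[k0 k1].
    have : 2 * B * (k%:R / n%:R) <= 2 * B * 1 by rewrite ler_wpM2l // ltW.
    have : 0 <= 2 * B * (k%:R / n%:R) by rewrite mulr_ge0 // ltW.
    by lra.
  rewrite lerD2l {1}xE.
  have -> : 2 * B * (k%:R / n%:R) - B - (2 * B * t - B) =
     2 * B * ((k%:R - n%:R * t) / n%:R) by field.
  rewrite exprMn [X in _ <= X](_ : _ = `|K| *
    ((2 * B) ^+ 2 * ((k%:R - n%:R * t) / n%:R) ^+ 2)).
    apply: ler_wpM2r; last exact: ler_norm.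
    by apply: mulr_ge0; exact: sqr_ge0.
  by rewrite /L; field.
have Ln : L / n%:R ^+ 2 * (n%:R * (t * (1 - t)) + (n%:R * t - n%:R * t) ^+ 2) <= eps / 2.
  rewrite subrr expr0n addr0 (_ : _ * _ = L / n%:R * (t * (1 - t))); last by field.
  apply: le_trans nL; rewrite ler_piMr ?divr_ge0 //; move: t01; nra.
pose bd (a c : R) k := a + c * ((k%:R : R) - n%:R * t) ^+ 2.
have up : (bernstein n g).[t] <=
    (bernstein n (bd (f x + eps / 2) (L / n%:R ^+ 2))).[t].
  by apply: bernstein_le => // k /gK; rewrite /bd ler_norml; lra.
have lo : (bernstein n (bd (f x - eps / 2) (- (L / n%:R ^+ 2)))).[t] <=
    (bernstein n g).[t].
  by apply: bernstein_le => // k /gK; rewrite /bd ler_norml; lra.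
move: up lo Ln; rewrite !(bernstein_quadratic _ _ (fun k => erefl)).
by rewrite ler_norml; lra.
Qed.

End Weierstrass.

(** By the recurrence, multiplication by ['X] preserves the span of the [nbpoly], which contains 1
    and hence every monomial. *)
Lemma nbpoly_span (K : comNzRingType) (q : nat) (D : {poly K} -> Prop) :
  (forall a p r, D p -> D r -> D (a *: p + r)) ->
  (forall k, D (nbpoly K q k)) -> forall p, D p.
Proof.
move=> Dlin DP p.
have D0 : D 0 by rewrite -(addNr (nbpoly K q 0)) -scaleN1r; exact: Dlin.
have DX m k : D ('X^m * nbpoly K q k).
  elim: m k => [|m IH] k; first by rewrite mul1r.
  rewrite exprSr -mulrA.
  case: k => [|k]; first by rewrite mulr1; exact: (IH 1%N).
  have -> : 'X * nbpoly K q k.+1 =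
      (q + (k == 0%N))%:R *: nbpoly K q k + nbpoly K q k.+2.
    by rewrite nbpolySS addrC subrK.
  by rewrite mulrDr -scalerAr; exact: Dlin.
rewrite -[p]coefK poly_def; elim/big_rec: _ => [//|i r _ Dr].
by apply: Dlin => //; rewrite -['X^_]mulr1; exact: (DX i 0%N).
Qed.

Section EmpiricalMean.
Local Open Scope classical_set_scope.
Variable R : realType.
Implicit Types (s t : seq R) (f g : R -> R).

Definition emp_mean s f : R := (size s)%:R^-1 * \sum_(x <- s) f x.

Lemma emp_mean_lin s a f g :
  emp_mean s (fun x => a * f x + g x) = a * emp_mean s f + emp_mean s g.
Proof. by rewrite /emp_mean big_split -mulr_sumr /=; ring. Qed.

Lemma emp_mean_cst s c : (0 < size s)%N -> emp_mean s (fun=> c) = c.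
Proof.
move=> s0; rewrite /emp_mean big_const_seq count_predT iter_addr_0.
by rewrite -[c *+ _]mulr_natl mulKf // pnatr_eq0 -lt0n.
Qed.

Lemma emp_mean_close s f g e : (0 < size s)%N ->
  (forall x, x \in s -> `|f x - g x| <= e) ->
  `|emp_mean s f - emp_mean s g| <= e.
Proof.
move=> s0 fg; rewrite /emp_mean -mulrBr -sumrB normrM normfV normr_nat mulrC.
rewrite ler_pdivrMr ?ltr0n //; apply: le_trans (ler_norm_sum _ _ _) _.
have -> : e * (size s)%:R = \sum_(x <- s) e.
  by rewrite big_const_seq count_predT iter_addr_0 mulr_natr.
by rewrite big_seq [leRHS]big_seq; exact: ler_sum.
Qed.

(** A three-epsilon argument: all points lie in [-B, B], where a polynomial approximates [f]
    uniformly. *)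
Lemma emp_mean_dense (s t : nat -> seq R) (B : R) :
  0 < B ->
  (forall n, (0 < size (s n))%N) -> (forall n, (0 < size (t n))%N) ->
  (forall n x, x \in s n -> `|x| <= B) -> (forall n x, x \in t n -> `|x| <= B) ->
  (forall p : {poly R},
     (emp_mean (s n) (horner p) - emp_mean (t n) (horner p)) @[n --> \oo] --> 0) ->
  forall f, continuous f ->
     (emp_mean (s n) f - emp_mean (t n) f) @[n --> \oo] --> 0.
Proof.
move=> B0 s0 t0 sB tB cvp f cf; apply/cvgrPdist_le => e e0.
have e30 : 0 < e / 3 by rewrite divr_gt0.
have [p fp] := weierstrass cf B0 e30.
have /cvgrPdist_le/(_ _ e30) := cvp p.
apply: filterS => n; rewrite !sub0r !normrN => pn.
have fs := emp_mean_close (s0 n) (fun x xs => fp x (sB n x xs)).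
have ft := emp_mean_close (t0 n) (fun x xt => fp x (tB n x xt)).
set a := emp_mean (s n) f in fs *; set b := emp_mean (t n) f in ft *.
move: pn fs ft; set c := emp_mean _ _; set d := emp_mean _ _.
by rewrite !ler_norml; lra.
Qed.

End EmpiricalMean.

(** * The Kesten-McKay distribution *)

(* [chebU K k.+1] is the Chebyshev polynomial U_k evaluated at x/2. *)
Fixpoint chebU (K : comNzRingType) (k : nat) : {poly K} :=
  match k with
  | 0 => 0
  | k1.+1 => match k1 with
    | 0 => 1
    | k2.+1 => 'X * chebU K k1 - chebU K k2
    end
  end.

Lemma chebUSS (K : comNzRingType) (k : nat) :
  chebU K k.+2 = 'X * chebU K k.+1 - chebU K k.
Proof. by []. Qed.

(** The left side is sqrt(4 - x^2) times the derivative of sqrt(4 - x^2) [chebU K k.+1]. With x = 2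
    cos t, [chebU K k] is sin(k t) / sin t, and the identity differentiates sin((k+1) t). *)
Lemma chebU_deriv (K : comNzRingType) (k : nat) :
  (4 - 'X ^+ 2) * (chebU K k.+1)^`() - 'X * chebU K k.+1 =
  k.+1%:R * (chebU K k - chebU K k.+2).
Proof.
suff H j : (4 - 'X ^+ 2) * (chebU K j)^`() =
    2 * j%:R * chebU K j.-1 - j.-1%:R * 'X * chebU K j /\
  (4 - 'X ^+ 2) * (chebU K j.+1)^`() =
    2 * j.+1%:R * chebU K j - j%:R * 'X * chebU K j.+1.
  have [_ ->] := H k; rewrite chebUSS -[k.+1%:R]natr1; ring.
elim: j => [|j [IH1 IH2]].
  by rewrite /= (derivC 1) deriv0; split; ring.
split => //=; rewrite -/(chebU K j.+1) derivB derivM derivX mul1r.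
rewrite mulrBr mulrDr [X in _ + X - _]mulrCA IH2 IH1.
case: j {IH1 IH2} => [|j].
  by rewrite /=; ring.
rewrite /= -/(chebU K j.+1) -[j.+3%:R]natr1 -[j.+2%:R]natr1 -[j.+1%:R]natr1.
ring.
Qed.

(** An invariant of the recurrence, used to bound [chebU] times sqrt(4 - x^2) on [-2, 2]. *)
Lemma chebU_quadratic (K : comNzRingType) (k : nat) :
  chebU K k.+1 ^+ 2 - 'X * chebU K k.+1 * chebU K k + chebU K k ^+ 2 = 1.
Proof.
elim: k => [|k IH]; first by rewrite /=; ring.
rewrite chebUSS -{}[RHS]IH; ring.
Qed.

(** In the usual indexing this is U_(k+1) - U_(k-1)/q, with [chebU R 0 = 0] in the role of U_(-1).
    The exceptional coefficient q + 1 of [nbpoly] accounts for the term U_0/q. *)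
Lemma horner_nbpoly_chebU (R : realType) (q k : nat) (x : R) : (0 < q)%N ->
  (nbpoly R q k.+1).[Num.sqrt q%:R * x] =
  Num.sqrt q%:R ^+ k.+1 * ((chebU R k.+2).[x] - (chebU R k).[x] / q%:R).
Proof.
move=> q0; set r := Num.sqrt q%:R.
have rr : r ^+ 2 = q%:R by rewrite sqr_sqrtr.
have r0 : r != 0 by rewrite gt_eqF // sqrtr_gt0 ltr0n.
rewrite -rr.
suff H j : (nbpoly R q j.+1).[r * x] =
    r ^+ j.+1 * ((chebU R j.+2).[x] - (chebU R j).[x] / r ^+ 2) /\
  (nbpoly R q j.+2).[r * x] =
    r ^+ j.+2 * ((chebU R j.+3).[x] - (chebU R j.+1).[x] / r ^+ 2).
  by case: (H k).
elim: j => [|j [IH1 IH2]].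
  rewrite /= !(hornerD, hornerM, hornerX, hornerN, hornerC, hornerZ).
  by rewrite natrD -rr; split; field.
split => //; rewrite nbpolySS.
rewrite hornerD hornerN hornerZ hornerM hornerX IH1 IH2 addn0 -rr.
have USS i : (chebU R i.+2).[x] = x * (chebU R i.+1).[x] - (chebU R i).[x].
  by rewrite chebUSS hornerD hornerN hornerM hornerX.
by rewrite (USS j.+2) (USS j.+1) (USS j) !exprS; field.
Qed.

Section ArcsineIntegral.
Local Open Scope classical_set_scope.
Variable R : realType.
Notation mu := (@lebesgue_measure R).

(** Meant for integrands unbounded at the end points: [F] minus the indefinite integral has zero
    derivative inside and is continuous up to the ends, so it takes equal values there. *)
Lemma Rintegral_FTC_integrable (f F : R -> R) (a b : R) : a < b ->
  mu.-integrable `[a, b] (EFin \o f) ->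
  (forall x, x \in `]a, b[%R -> {for x, continuous f}) ->
  {within `[a, b], continuous F} ->
  (forall x, x \in `]a, b[%R -> is_derive x 1 F (f x)) ->
  Rintegral mu `[a, b] f = F b - F a.
Proof.
move=> ab intf cf cF dF.
pose G x := (\int[mu]_(t in `[a, x]) f t)%R.
have dG x : x \in `]a, b[%R -> is_derive x 1 G (f x).
  move=> xab; move: (xab); rewrite in_itv /= => /andP[ax xb].
  have [dGx Gx] := continuous_FTC1_closed xb intf ax (cf x xab).
  by apply: DeriveDef; [exact: dGx|rewrite -derive1E; exact: Gx].
have [c _] : exists2 c, c \in `]a, b[%R &
    (F b - G b) - (F a - G a) = 0 * (b - a).
  apply: (@MVT _ (fun x => F x - G x) (fun=> 0) _ _ ab) => [x xab|].
    have dFx := dF x xab; have dGx := dG x xab.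
    by rewrite -(subrr (f x)); exact: is_deriveB.
  move=> x; apply: cvgB; first exact: cF.
  exact: (parameterized_integral_continuous (ltW ab) intf).
rewrite mul0r => /eqP; rewrite subr_eq0 => /eqP E.
have : G a = 0 by rewrite /G set_itv1 Rintegral_set1.
by rewrite -/(G b); lra.
Qed.

(** This is 1/sqrt(4 - x^2) inside ]-2, 2[; written so, it is everywhere a constant multiple of the
    density for q = 1. *)
Definition arcsine_weight (x : R) : R := Num.sqrt (4 - x ^+ 2) / (4 - x ^+ 2).

Let s (x : R) : R := Num.sqrt (4 - x ^+ 2).

Lemma semicircle_gt0 (x : R) : x \in `]-2, 2[%R -> 0 < 4 - x ^+ 2.
Proof. by rewrite in_itv /= => /andP[x1 x2]; nra. Qed.

Lemma continuous_semicircle : continuous s.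
Proof.
move=> x; apply: (@continuous_comp _ _ _ (fun x : R => 4 - x ^+ 2) Num.sqrt).
  by apply: cvgB; [exact: cvg_cst | exact: exprn_continuous].
exact: sqrt_continuous.
Qed.

Lemma is_derive_semicircle (x : R) : x \in `]-2, 2[%R ->
  is_derive x 1 s (- x * arcsine_weight x).
Proof.
move=> /semicircle_gt0 x4.
have dsq : is_derive x 1 (fun x : R => 4 - x ^+ 2) (- (2 * x)).
  by apply: trigger_derive; rewrite /GRing.scale /=; ring.
have := @is_derive1_comp R Num.sqrt (fun x => 4 - x ^+ 2) x _ _
  (is_derive1_sqrt x4) dsq.
rewrite -[s]/(Num.sqrt \o (fun x => 4 - x ^+ 2)) => ds.
apply: is_derive_eq.
have s0 : Num.sqrt (4 - x ^+ 2) != 0 by rewrite gt_eqF // sqrtr_gt0.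
rewrite /arcsine_weight -[X in _ / X](sqr_sqrtr (ltW x4)); field.
by [].
Qed.

Lemma arcsine_weight_sqrt x : (4 - x ^+ 2) * arcsine_weight x = s x.
Proof.
rewrite /arcsine_weight /s mulrC; have [->|n0] := eqVneq (4 - x ^+ 2) 0.
  by rewrite sqrtr0 mulr0.
by rewrite divfK.
Qed.

Lemma continuous_arcsine_weight x : x \in `]-2, 2[%R ->
  {for x, continuous arcsine_weight}.
Proof.
move=> /semicircle_gt0 x4; apply: continuousM; first exact: continuous_semicircle.
apply: continuousV; first by rewrite gt_eqF.
by apply: cvgB; [exact: cvg_cst | exact: exprn_continuous].
Qed.

(* The integrand is the derivative of [sqrt (4 - x^2) * r.[x]], which vanishes
   at the end points. *)
Lemma Rintegral_arcsine_weight (r : {poly R}) :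
  let g x := ((4 - 'X ^+ 2) * r^`() - 'X * r).[x] * arcsine_weight x in
  mu.-integrable `[-2, 2] (EFin \o g) -> Rintegral mu `[-2, 2] g = 0.
Proof.
move=> g intg.
pose F (x : R) : R := s x * r.[x].
have dF (x : R) : x \in `]-2, 2[%R -> is_derive x 1 F (g x).
  move=> xI; have ds := is_derive_semicircle xI.
  have := is_deriveM ds (is_derive_poly r x).
  rewrite -[(s * _)%R]/F => dF; apply: is_derive_eq.
  rewrite /g -arcsine_weight_sqrt /GRing.scale /=.
  rewrite !(hornerD, hornerM, hornerX, hornerN, hornerC); ring.
transitivity (F 2 - F (- 2)).
  apply: Rintegral_FTC_integrable => //; first by lra.
    move=> x xI; apply: continuousM; first exact: continuous_horner.
    exact: continuous_arcsine_weight.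
  apply: continuous_subspaceT => x; apply: continuousM.
    exact: continuous_semicircle.
  exact: continuous_horner.
rewrite /F /s sqrrN (_ : 4 - 2 ^+ 2 = 0) ?sqrtr0 ?mul0r ?subrr //; ring.
Qed.

End ArcsineIntegral.

Section KestenMcKay.
Local Open Scope classical_set_scope.
Variables (R : realType) (q : nat).
Hypothesis q_gt0 : (0 < q)%N.
Notation mu := (@lebesgue_measure R).
Notation w := (@kesten_mckay_density R q).

Let q0 : 0 < q%:R :> R. Proof. by rewrite ltr0n. Qed.

Lemma kesten_mckay_pole :
  ((Num.sqrt q%:R)^-1 + Num.sqrt q%:R) ^+ 2 = q%:R + 2 + q%:R^-1 :> R.
Proof.
have r0 : Num.sqrt q%:R != 0 :> R by rewrite gt_eqF // sqrtr_gt0.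
have rr : Num.sqrt q%:R ^+ 2 = q%:R :> R by rewrite sqr_sqrtr // ltW.
by move: r0 rr; set r := Num.sqrt _ => r0 <-; field.
Qed.

(** Equality holds for q = 1, where the denominator of the density vanishes at both end points. *)
Lemma kesten_mckay_pole_ge4 : 4 <= q%:R + 2 + q%:R^-1 :> R.
Proof.
have qV : q%:R * q%:R^-1 = 1 :> R by rewrite divff // gt_eqF.
have : 0 < q%:R^-1 :> R by rewrite invr_gt0.
have := sqr_ge0 (q%:R - 1 : R).
by move: q0 qV; set a := q%:R; set b := a^-1; nra.
Qed.

Lemma kesten_mckay_densityE x :
  w x = q.+1%:R / (2 * pi) *
    (Num.sqrt (4 - x ^+ 2) / (q%:R + 2 + q%:R^-1 - x ^+ 2)).
Proof. by rewrite /kesten_mckay_density kesten_mckay_pole -mulf_div. Qed.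

Lemma kesten_mckay_density_ge0 x : x \in `[-2, 2]%R -> 0 <= w x.
Proof.
rewrite in_itv /= => /andP[x1 x2]; rewrite kesten_mckay_densityE.
rewrite mulr_ge0 ?divr_ge0 ?mulr_ge0 ?pi_ge0 ?sqrtr_ge0 //.
by have := kesten_mckay_pole_ge4; nra.
Qed.

Lemma measurable_kesten_mckay_density : measurable_fun (`[(-2)%R, 2%R] : set R) w.
Proof.
(* The end points are dropped: for q = 1 the density is discontinuous there. *)
apply: (@measurable_fun_itv_cc R (-2) 2 false true).
apply: open_continuous_measurable_fun; first exact: interval_open.
move=> x; rewrite inE /= => xI.
have -> : w = (fun x : R => q.+1%:R / (2 * pi)) \*
    (fun x : R => Num.sqrt (4 - x ^+ 2) / (q%:R + 2 + q%:R^-1 - x ^+ 2)).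
  by apply/funext => y; rewrite kesten_mckay_densityE.
apply: continuousM; first exact: cvg_cst.
apply: continuousM; first exact: continuous_semicircle.
apply: continuousV.
  by rewrite gt_eqF //; have := semicircle_gt0 xI; have := kesten_mckay_pole_ge4; lra.
by apply: cvgB; [exact: cvg_cst | exact: exprn_continuous].
Qed.

(* A nonintegrable density would have the junk mass [fine +oo = 0]. *)
Hypothesis mass_neq0 : kesten_mckay q (fun=> 1 : R) != 0.

Lemma integrable_kesten_mckay_density : mu.-integrable `[(-2)%R, 2%R] (EFin \o w).
Proof.
apply/integrableP; split.
  by apply/measurable_EFinP; exact: measurable_kesten_mckay_density.
have -> : (\int[mu]_(x in `[(-2)%R, 2%R]) `|(EFin \o w) x| =
    \int[mu]_(x in `[(-2)%R, 2%R]) (1 * w x)%:E)%E.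
  apply: eq_integral => x; rewrite inE /= => xI.
  by rewrite ger0_norm ?mul1r ?kesten_mckay_density_ge0.
rewrite ltey; apply: contra mass_neq0 => /eqP oo.
by rewrite /kesten_mckay /Rintegral oo.
Qed.

Lemma integrable_poly_kesten_mckay (p : {poly R}) :
  mu.-integrable `[(-2)%R, 2%R] (EFin \o (fun x => p.[x] * w x)).
Proof.
have [M pM] := poly_disk_bound p 2.
apply: (@integrableMr _ _ _ mu _ (measurable_itv _) (horner p) (EFin \o w)) => //.
- exact: (measurable_funTS (continuous_measurable_fun (@continuous_horner _ p))).
- exists M; split; first exact: num_real.
  move=> K MK x /=; rewrite in_itv /= -ler_norml => /pM h.
  exact: le_trans h (ltW MK).
exact: integrable_kesten_mckay_density.
Qed.

Lemma kesten_mckay_poly_lin a (p r : {poly R}) :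
  kesten_mckay q (horner (a *: p + r)) =
  a * kesten_mckay q (horner p) + kesten_mckay q (horner r).
Proof.
rewrite /kesten_mckay -RintegralZl //; last exact: integrable_poly_kesten_mckay.
rewrite -RintegralD //; last exact: integrable_poly_kesten_mckay.
  by apply: eq_Rintegral => x _; rewrite hornerD hornerZ; ring.
have := integrable_poly_kesten_mckay (a *: p).
by apply: eq_integrable => // x _; rewrite /= hornerZ mulrA.
Qed.

Lemma kesten_mckay_polyZ a (p : {poly R}) :
  kesten_mckay q (horner (a *: p)) = a * kesten_mckay q (horner p).
Proof.
have -> : a *: p = (a - 1) *: p + p by rewrite scalerBl scale1r subrK.
by rewrite kesten_mckay_poly_lin; ring.
Qed.

Let K : R := q.+1%:R / (2 * pi).

Let K_gt0 : 0 < K.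
Proof. by rewrite divr_gt0 ?ltr0n // mulr_gt0 ?pi_gt0. Qed.

(** Multiplying by the denominator of the density leaves the semicircle weight, to which
    [chebU R k.+2] is orthogonal; the product expands by the Chebyshev recurrence. *)
Lemma kesten_mckay_chebU_rec k :
  kesten_mckay q (horner (chebU R k.+4)) =
  (q%:R + q%:R^-1) * kesten_mckay q (horner (chebU R k.+2))
  - kesten_mckay q (horner (chebU R k)).
Proof.
set V := chebU R.
(* By [chebU_deriv], sqrt(4 - x^2) r is a primitive of sqrt(4 - x^2) [V k.+2]. *)
pose r := k.+3%:R^-1 *: V k.+3 - k.+1%:R^-1 *: V k.+1.
have rE : (4 - 'X ^+ 2) * r^`() - 'X * r = (4 - 'X ^+ 2) * V k.+2.
  have invP m : (m.+1%:R^-1)%:P * m.+1%:R = 1 :> {poly R}.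
    by rewrite -polyC_natr -polyCM mulVf ?pnatr_eq0.
  have -> : (4 - 'X ^+ 2) * r^`() - 'X * r =
      (k.+3%:R^-1)%:P * ((4 - 'X ^+ 2) * (V k.+3)^`() - 'X * V k.+3) -
      (k.+1%:R^-1)%:P * ((4 - 'X ^+ 2) * (V k.+1)^`() - 'X * V k.+1).
    by rewrite /r derivB !derivZ -!mul_polyC; ring.
  rewrite !chebU_deriv !mulrA !invP !mul1r -/V.
  by rewrite /V (chebUSS _ k.+2) (chebUSS _ k.+1) (chebUSS _ k); ring.
have Vint : Rintegral mu `[-2, 2] (fun x => (V k.+2).[x] * Num.sqrt (4 - x ^+ 2)) = 0.
  have gE : (fun x => (V k.+2).[x] * Num.sqrt (4 - x ^+ 2)) =
      (fun x => ((4 - 'X ^+ 2) * r^`() - 'X * r).[x] * arcsine_weight x).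
    apply/funext => x; rewrite rE -arcsine_weight_sqrt.
    by rewrite !(hornerD, hornerM, hornerX, hornerN, hornerC); ring.
  rewrite gE; apply: Rintegral_arcsine_weight; rewrite -gE.
  apply: continuous_compact_integrable; first exact: segment_compact.
  apply: continuous_subspaceT => x; apply: continuousM.
    exact: continuous_horner.
  exact: continuous_semicircle.
have : kesten_mckay q (horner (((q%:R + 2 + q%:R^-1)%:P - 'X ^+ 2) * V k.+2)) = 0.
  rewrite /kesten_mckay -[RHS](mulr0 K) -[in RHS]Vint -RintegralZl //.
    apply: eq_Rintegral => x; rewrite inE /= => xI.
    rewrite kesten_mckay_densityE -/K.
    rewrite !(hornerD, hornerM, hornerX, hornerN, hornerC).
    (* Where the denominator vanishes, the square root vanishes too. *)
    have [c0|c0] := eqVneq (q%:R + 2 + q%:R^-1 - x ^+ 2) 0; last first.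
      by move: c0; set c := (_ + 2 + _) => c0; field.
    rewrite ler0_sqrtr ?mulr0 ?mul0r ?mulr0 //.
    by move: c0 kesten_mckay_pole_ge4; lra.
  apply: continuous_compact_integrable; first exact: segment_compact.
  apply: continuous_subspaceT => x; apply: continuousM.
    exact: continuous_horner.
  exact: continuous_semicircle.
have -> : ((q%:R + 2 + q%:R^-1)%:P - 'X ^+ 2) * V k.+2 =
    (q%:R + q%:R^-1) *: V k.+2 + ((-1) *: V k.+4 + (-1) *: V k).
  rewrite -!mul_polyC /V (chebUSS _ k.+2) (chebUSS _ k.+1) (chebUSS _ k).
  by rewrite !polyCD; ring.
by rewrite !kesten_mckay_poly_lin kesten_mckay_polyZ; lra.
Qed.

(** For q >= 2 the denominator stays above [d] on [-2, 2], while [chebU] times the square root is at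
    most 2 in modulus. *)
Lemma kesten_mckay_chebU_bounded : (1 < q)%N ->
  exists C, forall k, `|kesten_mckay q (horner (chebU R k))| <= C.
Proof.
move=> q1.
have d0 : 0 < q%:R + 2 + q%:R^-1 - 4 :> R.
  have : 1 < q%:R :> R by rewrite ltr1n.
  have qV : q%:R * q%:R^-1 = 1 :> R by rewrite divff // gt_eqF.
  have : 0 < q%:R^-1 :> R by rewrite invr_gt0.
  by move: qV; set a := q%:R; set b := a^-1; nra.
set d := (X in 0 < X) in d0.
have intC (c : R) : mu.-integrable `[(-2)%R, 2%R] (EFin \o (fun=> c)).
  apply: continuous_compact_integrable; first exact: segment_compact.
  by apply: continuous_subspaceT => x; exact: cvg_cst.
exists (\int[mu]_(x in `[(-2)%R, 2%R]) (K * (2 / d)))%R => k.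
have intk := integrable_poly_kesten_mckay (chebU R k).
apply: le_trans (le_normr_Rintegral _ intk) _ => //.
apply: le_Rintegral => //.
  exact: (integrable_abse intk).
move=> x; rewrite /= in_itv /= => /andP[x1 x2].
have x4 : 0 <= 4 - x ^+ 2 by nra.
rewrite kesten_mckay_densityE -/K mulrCA normrM (gtr0_norm K_gt0).
rewrite ler_pM2l // mulrA normrM; apply: ler_pM => //.
  rewrite -(@ler_pXn2r _ 2) ?nnegrE // real_normK ?num_real //.
  rewrite exprMn sqr_sqrtr //.
  have := congr1 (horner^~ x) (chebU_quadratic R k).
  rewrite !(hornerD, hornerM, hornerX, hornerN, hornerC).
  set a := (chebU R k.+1).[x]; set b := (chebU R k).[x] => E.
  (* Four times [E] reads (2a - x b)^2 + (4 - x^2) b^2 = 4. *)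
  by have := sqr_ge0 (2 * a - x * b); nra.
have dx : d <= q%:R + 2 + q%:R^-1 - x ^+ 2 by rewrite /d; lra.
by rewrite gtr0_norm ?invr_gt0 ?lef_pV2 ?posrE //; exact: lt_le_trans dx.
Qed.

Lemma kesten_mckay_chebU k :
  kesten_mckay q (horner (chebU R k.+2)) = kesten_mckay q (horner (chebU R k)) / q%:R.
Proof.
have [q1|q1] := leqP q 1.
  have qE : q = 1%N by apply/eqP; rewrite eqn_leq q1.
  (* For q = 1 the weight is the arcsine one, and sqrt(4 - x^2) r is a primitive of the
     difference. *)
  pose r := (- k.+1%:R^-1) *: chebU R k.+1.
  have rE : (4 - 'X ^+ 2) * r^`() - 'X * r = chebU R k.+2 - chebU R k.
    have -> : (4 - 'X ^+ 2) * r^`() - 'X * r =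
      - (k.+1%:R^-1)%:P * ((4 - 'X ^+ 2) * (chebU R k.+1)^`() - 'X * chebU R k.+1).
      by rewrite /r derivZ -!mul_polyC polyCN; ring.
    have invP : (k.+1%:R^-1)%:P * k.+1%:R = 1 :> {poly R}.
      by rewrite -polyC_natr -polyCM mulVf ?pnatr_eq0.
    by rewrite chebU_deriv mulrA mulNr invP; ring.
  have wE x : w x = K * arcsine_weight x.
    rewrite kesten_mckay_densityE -/K /arcsine_weight qE invr1.
    by congr (_ * (_ / _)); ring.
  have intr : mu.-integrable `[(-2)%R, 2%R] (EFin \o (fun x =>
      ((4 - 'X ^+ 2) * r^`() - 'X * r).[x] * arcsine_weight x)).
    have := integrable_poly_kesten_mckay (K^-1 *: (chebU R k.+2 - chebU R k)).
    congr (mu.-integrable _ (EFin \o _)); apply/funext => x.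
    by rewrite rE hornerZ wE; field; rewrite gt_eqF.
  have : kesten_mckay q (horner ((-1) *: chebU R k + chebU R k.+2)) = 0.
    rewrite /kesten_mckay -[RHS](mulr0 K) -[in RHS](Rintegral_arcsine_weight intr).
    rewrite -RintegralZl //; apply: eq_Rintegral => x _.
    rewrite rE wE scaleN1r addrC; ring.
  by rewrite kesten_mckay_poly_lin qE divr1; lra.
have [C JC] := kesten_mckay_chebU_bounded q1.
(* The defect [b] is multiplied by [q] at each double step, yet stays bounded; hence it is zero. *)
pose b j := kesten_mckay q (horner (chebU R j.+2)) -
  kesten_mckay q (horner (chebU R j)) / q%:R.
have bS j : b j.+2 = q%:R * b j.
  by rewrite /b kesten_mckay_chebU_rec; field; rewrite gt_eqF.
have bX m : b (k + m.*2)%N = q%:R ^+ m * b k.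
  elim: m => [|m IH]; first by rewrite addn0 mul1r.
  by rewrite doubleS !addnS bS IH exprS mulrA.
have bC j : `|b j| <= C + C.
  apply: le_trans (ler_normB _ _) (lerD (JC _) _).
  rewrite normrM; apply: le_trans (JC j); rewrite ler_piMr //.
  by rewrite normfV ger0_norm ?(ltW q0) // invf_le1 // ler1n.
apply/eqP; rewrite -subr_eq0 -/(b k) -normr_le0 leNgt; apply/negP => bk0.
(* Such an [m] contradicts the bound, because q^m >= m. *)
have [m] : exists m, (C + C) / `|b k| < m%:R.
  by exists (Num.trunc ((C + C) / `|b k|)).+1; exact: truncnS_gt.
rewrite ltNge => /negP; apply; rewrite ler_pdivlMr //.
apply: le_trans (bC (k + m.*2)%N); rewrite bX normrM ler_pM2r //.
rewrite normrX normr_nat -natrX ler_nat.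
exact/ltnW/ltn_expl.
Qed.

Lemma kesten_mckay_nbpoly k :
  kesten_mckay q (fun x : R => (nbpoly R q k.+1).[Num.sqrt q%:R * x]) = 0.
Proof.
have -> : (fun x : R => (nbpoly R q k.+1).[Num.sqrt q%:R * x]) =
  horner (Num.sqrt q%:R ^+ k.+1 *: ((- q%:R^-1) *: chebU R k + chebU R k.+2)).
  apply/funext => x; rewrite horner_nbpoly_chebU // [RHS]hornerZ.
  by congr (_ * _); rewrite [RHS]hornerD [X in _ = X + _]hornerZ; ring.
by rewrite kesten_mckay_polyZ kesten_mckay_poly_lin kesten_mckay_chebU; ring.
Qed.

End KestenMcKay.

(** * Comparison of the spectral measures *)

Section SpectralMeasures.
Local Open Scope classical_set_scope.
Variables (R : realType) (q : nat).
Hypothesis q_gt0 : (0 < q)%N.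

Let sqrtq_ge1 : 1 <= Num.sqrt q%:R :> R.
Proof. by rewrite -[X in X <= _]sqrtr1 ler_wsqrtr // ler1n. Qed.

Let sqrtq_gt0 : 0 < Num.sqrt q%:R :> R.
Proof. exact: lt_le_trans ltr01 sqrtq_ge1. Qed.

Section OneGraph.
Variables (G : graph) (N : nat) (sigma : darc G -> 'M[R[i]]_N).
Hypothesis G_regular : regular q G.
Hypothesis vert_gt0 : (0 < #|vert G|)%N.
Hypothesis N_gt0 : (0 < N)%N.
Hypothesis sigma_color : is_color (@unitary R N) sigma.

Lemma mu_colored_emp_mean f :
  mu_colored q sigma f =
  emp_mean (real_eigenvalues (colored_adjacency sigma))
    (fun x => f (x / Num.sqrt q%:R)).
Proof. by rewrite /mu_colored /emp_mean (size_eigenvalues G_regular sigma_color). Qed.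

Lemma emp_mean_nbpoly_le k :
  `|emp_mean (real_eigenvalues (colored_adjacency sigma)) (horner (nbpoly R q k.+1))|
  <= (nbcount G k)%:R / #|vert G|%:R.
Proof.
rewrite /emp_mean (size_eigenvalues G_regular sigma_color) normrM normfV normr_nat.
rewrite mulrC ler_pdivrMr ?ltr0n ?muln_gt0 ?N_gt0 //.
apply: le_trans (sum_nbpoly_eigenvalues_le G_regular sigma_color k) _.
rewrite !natrM mulrCA -[X in _ <= N%:R * X]mulrA mulVf ?mulr1 //.
by rewrite pnatr_eq0 -lt0n.
Qed.

End OneGraph.

Lemma emp_mean_nbpoly_trivial_color (G : graph) (N k : nat) :
  regular q G -> (0 < #|vert G|)%N -> (0 < N)%N ->
  emp_mean (real_eigenvalues (colored_adjacency
    (fun _ : darc G => 1%:M : 'M[R[i]]_N))) (horner (nbpoly R q k.+1))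
  = (nbcount G k)%:R / #|vert G|%:R.
Proof.
move=> Gr V0 N0; rewrite /emp_mean (size_eigenvalues Gr (@trivial_color R G N)).
rewrite sum_nbpoly_trivial_color // !natrM.
by field; rewrite !pnatr_eq0 -!lt0n V0 N0.
Qed.

Variables (G : nat -> graph) (N : nat -> nat).
Variable sigma : forall n, darc (G n) -> 'M[R[i]]_(N n).
Hypothesis G_regular : forall n, regular q (G n).
Hypothesis vert_gt0 : forall n, (0 < #|vert (G n)|)%N.
Hypothesis N_gt0 : forall n, (0 < N n)%N.
Hypothesis sigma_color : forall n, is_color (@unitary R (N n)) (@sigma n).

Let eigs n := real_eigenvalues (colored_adjacency (@sigma n)).
Let eigs1 n := real_eigenvalues (colored_adjacency
  (fun _ : darc (G n) => 1%:M : 'M[R[i]]_1)).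

Let color1 n : is_color (@unitary R 1) (fun _ : darc (G n) => 1%:M).
Proof. exact: trivial_color. Qed.

Lemma mu_graph_emp_mean n f :
  mu_graph q (G n) f = emp_mean (eigs1 n) (fun x => f (x / Num.sqrt q%:R)).
Proof. by rewrite mu_graph_trivial_color // mu_colored_emp_mean. Qed.

Let size_eigs n : (0 < size (eigs n))%N.
Proof.
rewrite (size_eigenvalues (@G_regular n) (@sigma_color n)).
by rewrite muln_gt0 N_gt0 vert_gt0.
Qed.

Let size_eigs1 n : (0 < size (eigs1 n))%N.
Proof.
by rewrite (size_eigenvalues (@G_regular n) (@color1 n)) muln_gt0 vert_gt0.
Qed.

(** All spectra lie in [-(q+1), q+1], so polynomials suffice, and the [nbpoly] span them; at index 0
    both means are 1. *)
Lemma mu_colored_sub_mu_graph :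
  (forall k, (emp_mean (eigs n) (horner (nbpoly R q k.+1)) -
              emp_mean (eigs1 n) (horner (nbpoly R q k.+1))) @[n --> \oo] --> 0) ->
  forall f, continuous f ->
  (mu_colored q (@sigma n) f - mu_graph q (G n) f) @[n --> \oo] --> 0.
Proof.
move=> cvk f cf.
under eq_cvg do rewrite mu_colored_emp_mean // mu_graph_emp_mean.
apply: (@emp_mean_dense _ eigs eigs1 q.+1%:R) => //.
- by move=> n x; exact: eigenvalue_le.
- by move=> n x; exact: eigenvalue_le.
- apply: (@nbpoly_span _ q) => [a p r cp cr|[|k]].
  + have hE s : emp_mean s (horner (a *: p + r)) =
        a * emp_mean s (horner p) + emp_mean s (horner r).
      rewrite -emp_mean_lin; congr emp_mean; apply/funext => x.
      by rewrite hornerD hornerZ.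
    rewrite -[X in _ --> X](addr0 0) -{1}[X in X + 0](mulr0 a).
    have -> : (fun n => emp_mean (eigs n) (horner (a *: p + r)) -
        emp_mean (eigs1 n) (horner (a *: p + r))) =
      (fun n => a * (emp_mean (eigs n) (horner p) - emp_mean (eigs1 n) (horner p))
        + (emp_mean (eigs n) (horner r) - emp_mean (eigs1 n) (horner r))).
      by apply/funext => n; rewrite !hE; ring.
    by apply: cvgD => //; apply: cvgMr.
  + have h1 s : (0 < size s)%N -> emp_mean s (horner (nbpoly R q 0)) = 1.
      move=> sz; rewrite -[RHS](emp_mean_cst 1 sz); congr emp_mean.
      by apply/funext => x; rewrite hornerC.
    under eq_cvg do rewrite !h1 // subrr.
    exact: cvg_cst.
  + exact: cvk.
move=> x; apply: (@continuous_comp _ _ _ (fun x : R => x / Num.sqrt q%:R) f).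
  by apply: cvgM; [exact: cvg_id | exact: cvg_cst].
exact: cf.
Qed.

Lemma weakly_converges_colored :
  (forall k, (emp_mean (eigs n) (horner (nbpoly R q k.+1)) -
              emp_mean (eigs1 n) (horner (nbpoly R q k.+1))) @[n --> \oo] --> 0) ->
  forall nu : (R -> R) -> R,
  weakly_converges (fun n => mu_graph q (G n)) nu <->
  weakly_converges (fun n => mu_colored q (@sigma n)) nu.
Proof.
move=> /mu_colored_sub_mu_graph cvf nu; split=> cv f cf bf.
  have -> : (fun n => mu_colored q (@sigma n) f) = (fun n =>
      (mu_colored q (@sigma n) f - mu_graph q (G n) f) + mu_graph q (G n) f).
    by apply/funext => n; rewrite subrK.
  by rewrite -[nu f]add0r; apply: cvgD; [exact: cvf | exact: cv].
have -> : (fun n => mu_graph q (G n) f) = (fun n =>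
    mu_colored q (@sigma n) f - (mu_colored q (@sigma n) f - mu_graph q (G n) f)).
  by apply/funext => n; rewrite subKr.
by rewrite -[nu f]subr0; apply: cvgB; [exact: cv | exact: cvf].
Qed.

(** An unbounded polynomial is no test function, so it is first truncated outside a range containing
    all the spectra and [-2, 2]. *)
Lemma emp_mean_nbpoly_cvg0 k :
  weakly_converges (fun n => mu_graph (R := R) q (G n)) (kesten_mckay q) ->
  emp_mean (eigs1 n) (horner (nbpoly R q k.+1)) @[n --> \oo] --> 0.
Proof.
move=> cv.
pose B : R := q.+1%:R.
have B2 : 2 <= B by rewrite ler_nat.
(* The retraction of the line onto [-B, B]. *)
pose clamp (x : R) := (`|x + B| - `|x - B|) / 2.
have clampE x : `|x| <= B -> clamp x = x.
  rewrite ler_norml /clamp => /andP[x1 x2].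
  by rewrite ger0_norm ?ler0_norm; [field | lra | lra].
have clamp_le x : `|clamp x| <= B.
  rewrite /clamp normrM normfV normr_nat ler_pdivrMr //.
  apply: le_trans (ler_dist_dist _ _) _.
  by rewrite ger0_norm; lra.
(* Testing against the constant 1 shows that the limit has mass 1, which makes the density
   integrable. *)
have mass : kesten_mckay q (fun=> 1 : R) = 1.
  have h1 n : mu_graph q (G n) (fun=> 1 : R) = 1.
    by rewrite mu_graph_emp_mean emp_mean_cst // size_eigs1.
  have cv1 : (mu_graph q (G n) (fun=> 1 : R)) @[n --> \oo] --> kesten_mckay q (fun=> 1 : R).
    by apply: cv; [move=> x; exact: cvg_cst | exists 1 => x; rewrite normr1].
  have cv2 : (mu_graph q (G n) (fun=> 1 : R)) @[n --> \oo] --> (1 : R).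
    by under eq_cvg do rewrite h1; exact: cvg_cst.
  exact: (cvg_unique _ cv1 cv2).
pose p := nbpoly R q k.+1.
pose f (x : R) := p.[Num.sqrt q%:R * clamp x].
have cf : continuous f.
  move=> x; apply: (@continuous_comp _ _ _ (fun x : R => Num.sqrt q%:R * clamp x) (horner p)).
    apply: cvgM; first exact: cvg_cst.
    apply: cvgM; last exact: cvg_cst.
    apply: cvgB; apply: (@cvg_norm _ R^o).
      by apply: cvgD; [exact: cvg_id | exact: cvg_cst].
    by apply: cvgB; [exact: cvg_id | exact: cvg_cst].
  exact: continuous_horner.
have bf : exists M, forall x, `|f x| <= M.
  have [M pM] := poly_disk_bound p (Num.sqrt q%:R * B).
  exists M => x; apply: pM; rewrite normrM gtr0_norm // ler_pM2l //.
have <- : kesten_mckay q f = 0.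
  rewrite -(@kesten_mckay_nbpoly R q q_gt0 _ k) ?mass ?oner_neq0 //.
  apply: eq_Rintegral => x; rewrite inE /= in_itv /= => xI; congr (_ * _).
  by rewrite /f clampE // ler_norml; lra.
have <- : (fun n => mu_graph q (G n) f) =
    (fun n => emp_mean (eigs1 n) (horner p)).
  apply/funext => n; rewrite mu_graph_emp_mean /emp_mean; congr (_ * _).
  apply: eq_big_seq => x /(eigenvalue_le (@G_regular n) (@color1 n)) xB.
  rewrite /f clampE.
    by rewrite mulrC divfK // gt_eqF.
  rewrite normrM normfV (gtr0_norm sqrtq_gt0) ler_pdivrMr //.
  by apply: le_trans xB _; rewrite ler_peMr // ler0n.
exact: cv.
Qed.

End SpectralMeasures.

(** * Weak convergence for all colors *)

Theorem theorem3p2 (R : realType) (q : nat) (G : nat -> graph)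
    (N : nat -> nat) (Gs : forall n : nat, 'M[R[i]]_(N n) -> Prop) :
  (0 < q)%N ->
  (forall n, regular q (G n)) ->
  (forall n, (0 < #|vert (G n)|)%N) ->
  (forall n, (0 < N n)%N) ->
  (forall n, unitary_subgroup (Gs n)) ->
  (weakly_converges (R := R) (fun n => mu_graph q (G n)) (kesten_mckay q) <->
   forall sigma : forall n : nat, darc (G n) -> 'M[R[i]]_(N n),
     (forall n, is_color (Gs n) (sigma n)) ->
     weakly_converges (R := R) (fun n => mu_colored q (sigma n)) (kesten_mckay q)).
Proof.
move=> q0 Gr V0 N0 Gsub.
have tr_emp n k := @emp_mean_nbpoly_trivial_color R q (G n) 1 k (Gr n) (V0 n) isT.
split=> [cv sigma color|cv].
  have ucolor n : is_color (@unitary R (N n)) (sigma n).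
    move=> e; have [Gse rev_e] := color n e; split=> //.
    by have [Gu _ _ _] := Gsub n; exact: Gu.
  apply: ((weakly_converges_colored Gr V0 N0 ucolor _ _).1 cv) => k.
  pose a n := emp_mean (real_eigenvalues (colored_adjacency
    (fun _ : darc (G n) => 1%:M : 'M[R[i]]_1))) (horner (nbpoly R q k.+1)).
  have cva : (a n @[n --> \oo] --> 0)%classic.
    exact: emp_mean_nbpoly_cvg0.
  rewrite -(subr0 0); apply: cvgB => //.
  (* The moments of the trivial color bound those of [sigma n] in modulus. *)
  apply: (@squeeze_cvgr _ _ _ _ (fun n => - a n) a) => //; last first.
    by rewrite -oppr0; exact: cvgN.
  apply: nearW => n; rewrite -ler_norml /a tr_emp.
  exact: emp_mean_nbpoly_le.
(* The converse needs only the identity colors, which take values in every subgroup. *)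
pose one n (e : darc (G n)) : 'M[R[i]]_(N n) := 1%:M.
have onec n : is_color (@unitary R (N n)) (@one n) by exact: trivial_color.
apply: (weakly_converges_colored Gr V0 N0 onec _ _).2 => [k|].
  (* Both moments equal the number of closed walks divided by |V|, whatever [N n] is. *)
  have -> : (fun n => emp_mean (real_eigenvalues (colored_adjacency (@one n)))
       (horner (nbpoly R q k.+1)) - emp_mean (real_eigenvalues (colored_adjacency
       (fun _ : darc (G n) => 1%:M : 'M[R[i]]_1))) (horner (nbpoly R q k.+1)))
      = (fun=> 0).
    by apply/funext => n; rewrite tr_emp emp_mean_nbpoly_trivial_color // subrr.
  exact: cvg_cst.
apply: cv => n e; rewrite /one invmx1; split=> //.
by have [_ ? _ _] := Gsub n.
Qed.
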